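(* For every $D\ge 3$, the set of $D$-edge-colorable graphs is neither meager nor comeager in $\mathfrak{G}^{\infty}_{\le D}$.
   Context: Graphs are simple. A graph is $D$-edge-colorable if its edges can be colored with $D$ colors so that edges sharing an endpoint get distinct colors. $\mathfrak{G}^{\infty}_{\le D}$ is the set of connected infinite graphs of maximum degree at most $D$, up to isomorphism. For a graph $G$ and $r\ge 0$, $B_r(G,v)$ is the subgraph induced by the vertices at distance at most $r$ from $v$, rooted at $v$, and $\mathfrak{B}_r(G)=\{B_r(G,v): v\in V(G)\}$, a set of rooted graphs up to root-preserving isomorphism (multiplicities ignored). $\mathfrak{G}^{\infty}_{\le D}$ carries the topology of the pseudometric $d(G_1,G_2)=\inf\{2^{-r}: \mathfrak{B}_r(G_1)=\mathfrak{B}_r(G_2)\}$. A subset $S$ of a space $X$ is nowhere dense in $X$ if every non-empty open $U\subseteq X$ contains a non-empty open $U'\subseteq U$ with $U'\cap S=\emptyset$; meager if it is a countable union of nowhere dense sets; comeager if its complement is meager. *)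

(* Defs.v *)
From HB Require Import structures.
From mathcomp Require Import all_boot all_order all_algebra.
From mathcomp Require Import all_classical all_reals all_analysis.

Set Implicit Arguments.
Unset Strict Implicit.
Unset Printing Implicit Defensive.

Import Order.TTheory GRing.Theory Num.Theory.

Local Open Scope classical_set_scope.
Local Open Scope quotient_scope.
Local Open Scope ring_scope.

Record sgraph := SGraph {
  vertex :> Type;
  adj : rel vertex;
  adj_sym : symmetric adj;
  adj_irr : irreflexive adj }.

Arguments adj {s}.

Record rgraph := RGraph { rg_graph :> sgraph; rg_root : rg_graph }.

Definition isomorphic (G H : sgraph) : Prop :=
  exists f : G -> H, bijective f /\ forall x y, adj (f x) (f y) = adj x y.

Definition rooted_isomorphic (G H : rgraph) : Prop :=
  exists f : G -> H, [/\ bijective f, forall x y, adj (f x) (f y) = adj x y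
    & f (rg_root G) = rg_root H].

Definition edges (G : sgraph) : set (set G) :=
  [set e | exists x y, adj x y /\ e = [set x; y]].

(* Only the values of c on edges matter. *)
Definition edge_colorable (D : nat) (G : sgraph) : Prop :=
  exists c : set G -> nat,
    (forall e, edges e -> (c e < D)%N) /\
    (forall e e', edges e -> edges e' -> e <> e' -> e `&` e' !=set0 ->
       c e <> c e').

Definition dist_le (G : sgraph) (r : nat) (x y : G) : Prop :=
  exists p : seq G, [/\ path adj x p, last x p = y & (size p <= r)%N].

Definition connected_graph (G : sgraph) : Prop :=
  forall x y : G, exists r, dist_le r x y.

Definition max_degree_le (D : nat) (G : sgraph) : Prop :=
  forall x : G, ([set y | adj x y] #<= `I_D)%card.

Lemma dist_lexx (G : sgraph) r (x : G) : dist_le r x x.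
Proof. by exists [::]. Qed.

Section Induced.
Variables (G : sgraph) (A : set G).

(* A plain sigma type: the carrier set_type A would force the universe of
   vertices to be that of the sets of graphs. *)
Definition induced_adj : rel {x : G | A x} :=
  fun x y => adj (sval x) (sval y).

Lemma induced_sym : symmetric induced_adj.
Proof. by move=> x y; exact: adj_sym. Qed.

Lemma induced_irr : irreflexive induced_adj.
Proof. by move=> x; exact: adj_irr. Qed.

Definition induced : sgraph := SGraph induced_sym induced_irr.

End Induced.

Definition gball (r : nat) (G : sgraph) (v : G) : rgraph :=
  @RGraph (induced [set w | dist_le r v w]) (exist _ v (dist_lexx r v)).

(* A set of rooted graphs up to isomorphism is encoded as an
   isomorphism-closed set of rooted graphs. *)
Definition gballs (r : nat) (G : sgraph) : set rgraph :=
  [set K | exists v : G, rooted_isomorphic K (gball r v)].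

Lemma rooted_isomorphic_refl G : rooted_isomorphic G G.
Proof. by exists id; split=> //; exists id. Qed.

Lemma rooted_isomorphic_sym G H :
  rooted_isomorphic G H -> rooted_isomorphic H G.
Proof.
move=> [f [[g fK gK] fadj froot]]; exists g; split.
- by exists f.
- by move=> x y; rewrite -fadj !gK.
- by rewrite -froot fK.
Qed.

Lemma rooted_isomorphic_trans G H K :
  rooted_isomorphic G H -> rooted_isomorphic H K -> rooted_isomorphic G K.
Proof.
move=> [f [fb fadj froot]] [g [gb gadj groot]]; exists (g \o f); split.
- exact: bij_comp.
- by move=> x y /=; rewrite gadj fadj.
- by rewrite /= froot groot.
Qed.

Lemma isomorphic_refl G : isomorphic G G.
Proof. by exists id; split=> //; exists id. Qed.

Lemma isomorphic_sym G H : isomorphic G H -> isomorphic H G.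
Proof.
move=> [f [[g fK gK] fadj]]; exists g; split; first by exists f.
by move=> x y; rewrite -fadj !gK.
Qed.

Lemma isomorphic_trans G H K :
  isomorphic G H -> isomorphic H K -> isomorphic G K.
Proof.
move=> [f [fb fadj]] [g [gb gadj]]; exists (g \o f); split.
  exact: bij_comp.
by move=> x y /=; rewrite gadj fadj.
Qed.

Lemma induced_val_inj (G : sgraph) (A : set G) :
  injective (fun x : induced A => sval x).
Proof. by move=> [x Ax] [y Ay] /= xy; exact: eq_exist. Qed.

Lemma gball_embed (G H : sgraph) (f : G -> H) m v :
  injective f -> (forall x y, adj (f x) (f y) = adj x y) ->
  (forall y, dist_le m (f v) y -> exists2 x, dist_le m v x & f x = y) ->
  rooted_isomorphic (gball m v) (gball m (f v)).
Proof.
move=> finj fadj fsurj.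
have fd x : dist_le m v x -> dist_le m (f v) (f x).
  move=> [p [pp pl ps]]; exists (map f p); split.
  - rewrite path_map (eq_path (e' := adj)) //.
  - by rewrite last_map pl.
  - by rewrite size_map.
have [|g gP] := @choice (gball m (f v)) (gball m v)
    (fun y x => f (sval x) = sval y).
  by move=> [y yd]; have [x xd xy] := fsurj _ yd; exists (exist _ x xd).
exists (fun x => exist _ (f (sval x)) (fd _ (svalP x))); split.
- exists g => x; first by apply/induced_val_inj/finj; rewrite gP.
  by apply/induced_val_inj; rewrite /= gP.
- by move=> x y; rewrite /= /induced_adj /= fadj.
- exact/induced_val_inj.
Qed.

Lemma gball_isomorphic (G H : sgraph) (f : G -> H) m v :
  bijective f -> (forall x y, adj (f x) (f y) = adj x y) ->
  rooted_isomorphic (gball m v) (gball m (f v)).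
Proof.
move=> fb fadj; apply: gball_embed => //; first exact: bij_inj.
move=> y [p [pp pl ps]]; have [g fK gK] := fb.
exists (g y); last exact: gK.
exists (map g p); split.
- rewrite -[v]fK path_map (eq_path (e' := adj)) // => a b /=.
  by rewrite -fadj !gK.
- by rewrite -[v]fK last_map pl.
- by rewrite size_map.
Qed.

Lemma gball_gball (G : sgraph) m r (v : G) : (m <= r)%N ->
  rooted_isomorphic (gball m (rg_root (gball r v))) (gball m v).
Proof.
move=> mr; apply: (@gball_embed (gball r v) G (fun x => sval x)) => //; first exact: induced_val_inj.
move=> y [p [pp pl ps]].
have {pp} [q [qp qm]] : exists q : seq (gball r v),
    path adj (rg_root (gball r v)) q /\ map (fun x => sval x) q = p.
  have {ps mr} : (size p <= r)%N by exact: leq_trans mr.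
  elim/last_ind: p {pl} pp => [_ _|p z IH]; first by exists [::].
  rewrite rcons_path size_rcons => /andP[pp pz] ps.
  have [q [qp qm]] := IH pp (ltnW ps).
  have zd : dist_le r v z.
    exists (rcons p z); split; last by rewrite size_rcons.
      by rewrite rcons_path pp.
    by rewrite last_rcons.
  exists (rcons q (exist _ z zd)); split.
    rewrite rcons_path qp /= /induced_adj /=.
    by rewrite -[X in adj X _](last_map (fun x => sval x) q) qm.
  by rewrite map_rcons qm.
exists (last (rg_root (gball r v)) q); last by rewrite -(last_map (fun x => sval x) q) qm.
by exists q; split=> //; rewrite -(size_map (fun x => sval x)) qm.
Qed.

Lemma rooted_isomorphic_gball (K L : rgraph) m : rooted_isomorphic K L ->
  rooted_isomorphic (gball m (rg_root K)) (gball m (rg_root L)).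
Proof. by move=> [f [fb fadj <-]]; exact: gball_isomorphic. Qed.

Lemma gballs_isomorphic (G H : sgraph) r :
  isomorphic G H -> gballs r G = gballs r H.
Proof.
wlog suff sub : G H / isomorphic G H -> gballs r G `<=` gballs r H.
  by move=> GH; apply/seteqP; split; apply: sub => //; exact: isomorphic_sym.
move=> [f [fb fadj]] K [v Kv]; exists (f v).
exact: rooted_isomorphic_trans Kv (gball_isomorphic r v fb fadj).
Qed.

Lemma gballs_le (G H : sgraph) m r : (m <= r)%N ->
  gballs r G = gballs r H -> gballs m G = gballs m H.
Proof.
move=> mr.
wlog suff sub : G H / gballs r G = gballs r H -> gballs m G `<=` gballs m H.
  by move=> GH; apply/seteqP; split; apply: sub.
move=> GH K [v Kv].
have [w vw] : gballs r H (gball r v).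
  by rewrite -GH; exists v; exact: rooted_isomorphic_refl.
exists w; apply: (rooted_isomorphic_trans Kv).
apply: rooted_isomorphic_trans (gball_gball w mr).
apply: rooted_isomorphic_trans (rooted_isomorphic_gball m vw).
exact/rooted_isomorphic_sym/gball_gball.
Qed.

Record cgraph (D : nat) := CGraph {
  cg_graph :> sgraph;
  cg_connected : connected_graph cg_graph;
  cg_infinite : infinite_set [set: cg_graph];
  cg_degree : max_degree_le D cg_graph }.

HB.instance Definition _ D := gen_eqMixin (cgraph D).
HB.instance Definition _ D := gen_choiceMixin (cgraph D).

Definition iso_rel (D : nat) : rel (cgraph D) :=
  fun G H => `[< isomorphic G H >].

Lemma iso_rel_refl D : reflexive (@iso_rel D).
Proof. by move=> G; apply/asboolP; exact: isomorphic_refl. Qed.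

Lemma iso_rel_sym D : symmetric (@iso_rel D).
Proof. by move=> G H; apply/asboolP/asboolP; exact: isomorphic_sym. Qed.

Lemma iso_rel_trans D : transitive (@iso_rel D).
Proof.
move=> H G K /asboolP GH /asboolP HK; apply/asboolP.
exact: isomorphic_trans GH HK.
Qed.

Canonical iso_equiv D :=
  EquivRel (@iso_rel D) (@iso_rel_refl D) (@iso_rel_sym D) (@iso_rel_trans D).

(* R only serves as the field of values of the pseudometric. *)
Definition graph_space (R : realType) (D : nat) : Type :=
  {eq_quot iso_equiv D}.

HB.instance Definition _ R D := Choice.on (graph_space R D).
HB.instance Definition _ R D := Quotient.on (graph_space R D).

Definition graph_dist (R : realType) (G H : sgraph) : R :=
  inf [set (2 ^- r : R) | r in [set r | gballs r G = gballs r H]].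

Definition class_dist (R : realType) (D : nat) (x y : graph_space R D) : R :=
  graph_dist R (repr x) (repr y).

Lemma pi_isomorphic (R : realType) D (G H : cgraph D) :
  \pi_(graph_space R D) G = \pi_(graph_space R D) H <-> isomorphic G H.
Proof. by split=> [/eqmodP/asboolP//|GH]; apply/eqmodP/asboolP. Qed.

Lemma class_distE (R : realType) D (G H : cgraph D) :
  class_dist (\pi_(graph_space R D) G) (\pi_(graph_space R D) H) =
  graph_dist R G H.
Proof.
have piE (K : cgraph D) r :
    gballs r (repr (\pi_(graph_space R D) K)) = gballs r K.
  by apply/gballs_isomorphic/(pi_isomorphic R); rewrite reprK.
rewrite /class_dist /graph_dist; congr (inf [set _ | r in _]).
by apply/seteqP; split=> r /=; rewrite !piE.
Qed.

Lemma gball0_root (G : sgraph) (v : G) (x : gball 0 v) : x = rg_root (gball 0 v).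
Proof.
apply: induced_val_inj => /=; have [p [_ pl]] := svalP x.
by rewrite leqn0 => /nilP p0; rewrite -pl p0.
Qed.

Lemma gball0_isomorphic (G H : sgraph) (v : G) (w : H) :
  rooted_isomorphic (gball 0 v) (gball 0 w).
Proof.
exists (fun=> rg_root (gball 0 w)); split=> //.
- by exists (fun=> rg_root (gball 0 v)) => x; rewrite [RHS]gball0_root.
- by move=> x y; rewrite (gball0_root x) (gball0_root y) !adj_irr.
Qed.

Lemma gballs0 D (G H : cgraph D) : gballs 0 G = gballs 0 H.
Proof.
wlog suff sub : G H / gballs 0 G `<=` gballs 0 H.
  by apply/seteqP; split; exact: sub.
have [w _] := infinite_setN0 (@cg_infinite D H).
move=> K [v Kv]; exists w.
exact: rooted_isomorphic_trans Kv (gball0_isomorphic v w).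
Qed.

Lemma graph_dist_lt (R : realType) D (G H : cgraph D) (e : R) :
  graph_dist R G H < e <->
  exists2 r, gballs r G = gballs r H & (2 ^- r : R) < e.
Proof.
split=> [|[r GH re]].
  move/inf_lt => [|_ [r GH <-] re]; last by exists r.
  by exists (2 ^- 0); exists 0%N => //; exact: gballs0.
apply: le_lt_trans re; apply: ge_inf; last by exists r.
by exists 0 => _ [s _ <-]; rewrite invr_ge0 exprn_ge0.
Qed.

Section Space.
Variables (R : realType) (D : nat).
Local Notation T := (graph_space R D).

Definition space_ball (x : T) (e : R) : set T := [set y | class_dist x y < e].

Lemma space_ball_center x (e : R) : 0 < e -> space_ball x e x.
Proof.
move=> e0; apply/graph_dist_lt.
have [r _ re] := near_infty_natSinv_expn_lt (PosNum e0).
by exists r => //; have := re r (leqnn r); rewrite div1r.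
Qed.

Lemma space_ball_sym x y (e : R) : space_ball x e y -> space_ball y e x.
Proof.
by rewrite /space_ball /= => /graph_dist_lt[r xy re]; apply/graph_dist_lt; exists r.
Qed.

Lemma space_ball_triangle x y z (e1 e2 : R) :
  space_ball x e1 y -> space_ball y e2 z -> space_ball x (e1 + e2) z.
Proof.
move=> /graph_dist_lt[r xy re1] /graph_dist_lt[s yz se2]; apply/graph_dist_lt.
have p2 k : 0 < 2 ^- k :> R by rewrite invr_gt0 exprn_gt0.
exists (minn r s).
  by rewrite (gballs_le (geq_minl r s) xy) (gballs_le (geq_minr r s) yz).
have e10 := lt_trans (p2 _) re1; have e20 := lt_trans (p2 _) se2.
case: (leqP r s) => _; first by rewrite (lt_trans re1)// ltrDl.
by rewrite (lt_trans se2)// ltrDr.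
Qed.

HB.instance Definition _ := hasNbhs.Build T (nbhs_ (entourage_ space_ball)).

HB.instance Definition _ := @Nbhs_isPseudoMetric.Build R T
  (entourage_ space_ball) erefl space_ball
  space_ball_center space_ball_sym space_ball_triangle erefl.

End Space.

Definition colorable_classes (R : realType) (D : nat) : set (graph_space R D) :=
  [set \pi_(graph_space R D) G | G in [set G : cgraph D | edge_colorable D G]].

Arguments colorable_classes : clear implicits.

Definition nowhere_dense (X : topologicalType) (S : set X) : Prop :=
  forall U : set X, open U -> U !=set0 ->
  exists U', [/\ open U', U' !=set0, U' `<=` U & U' `&` S = set0].

Definition meager (X : topologicalType) (S : set X) : Prop :=
  exists F : nat -> set X,
    (forall n, nowhere_dense (F n)) /\ S = \bigcup_n F n.

Definition comeager (X : topologicalType) (S : set X) : Prop := meager (~` S).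

(* Main.v *)
(* A set containing an isolated point is not meager, so it suffices to find a
   D-edge-colorable isolated point and one that is not D-edge-colorable.  Both
   are obtained by attaching an infinite ray to a vertex s of a finite connected
   graph K.  If no vertex of K has degree 2 in the result G, then G is isolated:
   a connected infinite graph H with the same r-balls, r being large compared
   with the diameter of K, contains a copy of K, and from the copy of s one can
   walk along vertices of degree 2, the walk going on forever because reaching
   another copy of K would make H finite.
   For K a single point, G is a ray and is 2-edge-colorable.  For K the graph
   K_(D,D) with an edge subdivided, the new vertex being s, already K is not
   D-edge-colorable: it has D^2 + 1 edges on 2D + 1 vertices. *)

Require Import Defs.
From mathcomp Require Import all_boot all_order all_algebra.
From mathcomp Require Import all_classical all_reals all_analysis.

Set Implicit Arguments.
Unset Strict Implicit.
Unset Printing Implicit Defensive.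

Import Order.TTheory GRing.Theory Num.Theory.

Local Open Scope classical_set_scope.
Local Open Scope quotient_scope.

(** * Edge colorings as functions of two endpoints *)

Lemma set2_eq (T : Type) (x y x' y' : T) : [set x; y] = [set x'; y'] ->
  (x = x' /\ y = y') \/ (x = y' /\ y = x').
Proof.
move=> /seteqP[s1 s2].
have := s1 x (or_introl erefl); have := s1 y (or_intror erefl).
have := s2 x' (or_introl erefl); have := s2 y' (or_intror erefl).
by move=> /= [?|?] [?|?] [?|?] [?|?]; subst; auto.
Qed.

(** A pair determines its endpoints up to order, so a symmetric [k] is well defined on edges;
    properness then amounts to injectivity around each vertex. *)
Lemma edge_colorableP (D : nat) (G : sgraph) :
  edge_colorable D G <->
  exists k : G -> G -> nat, [/\ forall x y, k x y = k y x,
    forall x y, adj x y -> (k x y < D)%N &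
    forall x y z, adj x y -> adj x z -> k x y = k x z -> y = z].
Proof.
split=> [[c [cD cne]]|[k [ksym kD kinj]]].
  exists (fun x y => c [set x; y]); split=> [x y|x y xy|x y z xy xz kE].
  - by rewrite setUC.
  - by apply: cD; exists x, y.
  - apply: contrapT => yz; apply: (cne [set x; y] [set x; z]) => //.
    + by exists x, y.
    + by exists x, z.
    + move=> /(@set2_eq _ _ _ _ _)[[_ //]|[xz' yx]]; apply: yz.
      by rewrite yx -xz'.
    + by exists x; split; left.
pose c e := xget 0%N [set n | exists x y, e = [set x; y] /\ n = k x y].
have cE x y : c [set x; y] = k x y.
  rewrite /c; case: xgetP => [n -> [x' [y' []]]|].
    by move=> /(@set2_eq _ _ _ _ _)[[<- <-]|[<- <-]] ->.
  by move=> /(_ (k x y)) []; exists x, y.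
exists c; split=> [_ [x [y [xy ->]]]|_ _ [x [y [xy ->]]] [x' [y' [xy' ->]]]].
  by rewrite cE kD.
move=> ne meet cc; apply: ne; move: cc; rewrite !cE.
have [z [/= zx zx']] := meet.
(* Reorients an edge so that the endpoint it shares with the other one comes first, as [kinj]
   requires. *)
have turn u v : adj u v -> [set u; v] z ->
    exists w, [/\ adj z w, [set u; v] = [set z; w] & k u v = k z w].
  by move=> uv [->|->]; [exists v|exists u; rewrite adj_sym setUC ksym].
have [w [zw -> ->]] := turn _ _ xy zx.
by have [w' [zw' -> ->]] := turn _ _ xy' zx' => /kinj ->.
Qed.

Lemma edge_colorable_embed (D : nat) (G H : sgraph) (f : G -> H) :
  injective f -> (forall x y, adj x y -> adj (f x) (f y)) ->
  edge_colorable D H -> edge_colorable D G.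
Proof.
move=> finj fadj /edge_colorableP[k [ksym kD kinj]]; apply/edge_colorableP.
exists (fun x y => k (f x) (f y)); split=> [x y|x y xy|x y z xy xz kE].
- exact: ksym.
- exact/kD/fadj.
- exact/finj/(kinj (f x))/kE/fadj/xz/fadj.
Qed.

(** * Distances and local isomorphisms *)

Lemma dist_leP (G : sgraph) r (v y : G) :
  dist_le r.+1 v y <-> dist_le r v y \/ exists2 x, dist_le r v x & adj x y.
Proof.
split=> [[p [pp pl ps]]|[[p [pp pl ps]]|[x [p [pp pl ps]] xy]]].
- case/lastP: p pp pl ps => [|p z]; first by move=> _ <- _; left; exists [::].
  rewrite rcons_path last_rcons size_rcons ltnS => /andP[pp pz] <- ps.
  by right; exists (last v p) => //; exists p.
- by exists p; split=> //; exact: leqW.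
- exists (rcons p y).
  by rewrite rcons_path last_rcons size_rcons ltnS pl pp xy.
Qed.

Lemma dist_le0 (G : sgraph) (v y : G) : dist_le 0 v y -> v = y.
Proof. by move=> [p [_ pl]]; rewrite leqn0 => /nilP p0; rewrite -pl p0. Qed.

Lemma dist_le_adj (G : sgraph) r (v x y : G) :
  dist_le r v x -> adj x y -> dist_le r.+1 v y.
Proof. by move=> vx xy; apply/dist_leP; right; exists x. Qed.

Lemma dist_le_mono (G : sgraph) r s (v x : G) : (r <= s)%N ->
  dist_le r v x -> dist_le s v x.
Proof.
by move=> rs [p [pp pl ps]]; exists p; split=> //; exact: leq_trans rs.
Qed.

Lemma connected_closed (G : sgraph) (C : set G) (x : G) :
  connected_graph G -> C x -> (forall y z, C y -> adj y z -> C z) -> C = setT.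
Proof.
move=> Gc Cx Cadj; apply/seteqP; split=> // y _; have [r] := Gc x y.
elim: r y => [y /dist_le0 <- //|r IH y /dist_leP[/IH//|[z /IH Cz zy]]].
exact: Cadj zy.
Qed.

(** Together with injectivity on the neighbours of [x], this makes [f] a local isomorphism at
    [x]. *)
Definition local_surj (G H : sgraph) (f : G -> H) (x : G) :=
  forall z, adj (f x) z <-> exists2 y, adj x y & f y = z.

(** One unit of radius is lost in the last clause because the neighbours of [x] must still lie in
    the ball where the isomorphism is defined. *)
Lemma gball_map (G H : sgraph) r (v : G) (w : H) :
  rooted_isomorphic (gball r.+1 v) (gball r.+1 w) ->
  exists f : G -> H, [/\ f v = w,
    forall x y, dist_le r.+1 v x -> dist_le r.+1 v y -> f x = f y -> x = y &
    forall x, dist_le r v x -> local_surj f x].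
Proof.
move=> [phi [[psi phiK psiK] phiadj phiroot]].
(* Outside the ball [w] is a mere placeholder; the conclusions only look inside. *)
pose f x := if pselect (dist_le r.+1 v x) is left h
            then sval (phi (exist _ x h)) else w.
have fE (x : gball r.+1 v) : f (sval x) = sval (phi x).
  rewrite /f; case: pselect => [h|/(_ (svalP x))//].
  by congr (sval (phi _)); exact: induced_val_inj.
have fadj x y : dist_le r.+1 v x -> dist_le r.+1 v y ->
    adj (f x) (f y) = adj x y.
  move=> hx hy; rewrite (fE (exist _ x hx)) (fE (exist _ y hy)).
  exact: phiadj.
have fv : f v = w by rewrite (fE (rg_root (gball r.+1 v))) phiroot.
(* Distances to the root do not grow, so the neighbours of [f x] stay in the domain of [psi]. *)
have fd k x : (k <= r)%N -> dist_le k v x -> dist_le k w (f x).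
  elim: k x => [x _ /dist_le0 <-|k IH x kr /dist_leP[vx|[y vy yx]]].
  - by rewrite /= fv; exact: dist_lexx.
  - by apply/dist_leP; left; exact: IH (ltnW kr) vx.
  - apply: (dist_le_adj (IH _ (ltnW kr) vy)); rewrite fadj //.
    + by apply: dist_le_mono vy; rewrite (leq_trans (ltnW kr)).
    + by apply: dist_le_mono (dist_le_adj vy yx); exact: leqW.
exists f; split=> // [x y hx hy|x hx z].
  rewrite (fE (exist _ x hx)) (fE (exist _ y hy)) => /induced_val_inj.
  by move=> /(can_inj phiK) [].
have hx1 := dist_le_mono (leqnSn r) hx.
split=> [xz|[y xy <-]]; last by rewrite fadj//; exact: dist_le_adj xy.
have hz := dist_le_adj (fd _ _ (leqnn r) hx) xz.
pose y := psi (exist _ z hz).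
have fy : f (sval y) = z by rewrite fE psiK.
by exists (sval y) => //; rewrite -fadj ?fy //; exact: svalP y.
Qed.

Lemma gballs_map (G H : sgraph) r : gballs r.+1 G = gballs r.+1 H ->
  forall w : H, exists v : G, exists f : G -> H, [/\ f v = w,
    forall x y, dist_le r.+1 v x -> dist_le r.+1 v y -> f x = f y -> x = y &
    forall x, dist_le r v x -> local_surj f x].
Proof.
move=> GH w; have [v wv] : gballs r.+1 G (gball r.+1 w).
  by rewrite GH; exists w; exact: rooted_isomorphic_refl.
exists v; exact/gball_map/rooted_isomorphic_sym.
Qed.

Definition degree2 (G : sgraph) (x : G) :=
  exists y z, y <> z /\ forall u, adj x u <-> u = y \/ u = z.

(** Degree two is the local mark that will separate ray vertices from vertices of [K] in an unknown
    graph. *)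
Lemma degree2_local (G H : sgraph) (f : G -> H) (x : G) :
  (forall y z, adj x y -> adj x z -> f y = f z -> y = z) ->
  local_surj f x -> degree2 x <-> degree2 (f x).
Proof.
move=> finj floc; split=> [[y [z [yz xE]]]|[y' [z' [yz' xE]]]].
  have xy : adj x y by apply/xE; left.
  have xz : adj x z by apply/xE; right.
  exists (f y), (f z); split=> [/finj|u]; first by auto.
  split=> [/floc[v /xE[->|->] <-]|[->|->]]; [by left|by right| |].
    by apply/floc; exists y.
  by apply/floc; exists z.
have /floc[y xy fy] : adj (f x) y' by apply/xE; left.
have /floc[z xz fz] : adj (f x) z' by apply/xE; right.
exists y, z; split=> [yz|u]; first by apply: yz'; rewrite -fy -fz yz.
split=> [xu|[->|->]//]; have /xE : adj (f x) (f u) by apply/floc; exists u.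
by rewrite -fy -fz => -[/finj|/finj] ->; auto.
Qed.

(** The image is closed under adjacency, hence everything by connectedness. An edge between images
    lifts, and injectivity identifies the end of the lift. *)
Lemma isomorphic_local (G H : sgraph) (f : G -> H) (x : G) :
  connected_graph H -> injective f -> (forall x, local_surj f x) ->
  isomorphic G H.
Proof.
move=> Hc finj floc; exists f.
have fsurj y : exists x, f x = y.
  have /seteqP[_ /(_ y I) [z _ <-]] : range f = setT.
    apply: (connected_closed (x := f x)) => //.
    by move=> _ z [u _ <-] /floc[v _ <-]; exists v.
  by exists z.
have [g gK] := choice fsurj; split.
  by exists g => [z|//]; apply: finj.
move=> y z; apply/idP/idP => [/floc[u yu /finj <-//]|yz].
by apply/floc; exists z.
Qed.

(** A walk entering [x] from [p] without turning back has a single way on. *)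
Lemma degree2_other (G : sgraph) (x p : G) : degree2 x -> adj x p ->
  exists q, q <> p /\ forall u, adj x u <-> u = p \/ u = q.
Proof.
move=> [y [z [yz xE]]] /xE[->|->]; first by exists z; split=> // /esym.
by exists y; split=> // u; rewrite xE or_comm.
Qed.

Lemma dist_le_trans (G : sgraph) r r' (x y z : G) :
  dist_le r x y -> dist_le r' y z -> dist_le (r + r') x z.
Proof.
move=> [p [pp pl ps]] [q [qp ql qs]]; exists (p ++ q).
by rewrite cat_path last_cat pl pp size_cat leq_add.
Qed.

Lemma dist_le_sym (G : sgraph) r (x y : G) : dist_le r x y -> dist_le r y x.
Proof.
move=> [p [pp pl ps]]; exists (rev (belast x p)); split.
- by rewrite -pl rev_path (eq_path (e' := adj)) // => u v; rewrite adj_sym.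
- by case: p {pp ps} pl => [//|z p] _; rewrite rev_cons last_rcons.
- by rewrite size_rev size_belast.
Qed.

(** * Attaching an infinite ray to a graph *)

Section RayExtension.
Variables (K : sgraph) (s : K).

Definition ray_adj : rel (K + nat) := fun x y =>
  match x, y with
  | inl u, inl v => adj u v
  | inl u, inr n | inr n, inl u => `[< u = s >] && (n == 0%N)
  | inr m, inr n => (n == m.+1) || (m == n.+1)
  end.

Lemma ray_adj_sym : symmetric ray_adj.
Proof. by move=> [u|m] [v|n] //=; [exact: adj_sym|rewrite orbC]. Qed.

Lemma ray_adj_irr : irreflexive ray_adj.
Proof.
move=> [u|m] /=; first exact: adj_irr.
by rewrite orbb; apply/negbTE; elim: m.
Qed.

Definition ray_graph : sgraph := SGraph ray_adj_sym ray_adj_irr.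

Definition ray_pred (n : nat) : ray_graph :=
  if n is m.+1 then inr m else inl s.

Lemma adj_inr n (x : ray_graph) :
  adj (inr n : ray_graph) x <-> x = ray_pred n \/ x = inr n.+1.
Proof.
split=> [|[]->]; last by rewrite /= eqxx.
  case: x => [v|m] /=; first by move=> /andP[/asboolP -> /eqP ->]; left.
  by move=> /orP[/eqP ->|/eqP ->]; [right|left].
by case: n => [|n] /=; rewrite ?asboolT// eqxx ?orbT.
Qed.

Lemma degree2_inr n : degree2 (inr n : ray_graph).
Proof.
exists (ray_pred n), (inr n.+1); split=> [|u]; last exact: adj_inr.
by case: n => [//|n] [] /eqP; apply/negP; elim: n.
Qed.

Lemma adj_ray_start : adj (inl s : ray_graph) (inr 0%N).
Proof. by rewrite /= eqxx asboolT. Qed.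

Lemma dist_le_inl r (u v : K) :
  dist_le r u v -> dist_le r (inl u : ray_graph) (inl v).
Proof.
move=> [p [pp pl ps]]; exists (map inl p).
by rewrite path_map last_map pl size_map.
Qed.

Lemma ray_graph_connected : connected_graph K -> connected_graph ray_graph.
Proof.
move=> Kcon.
have from_s (x : ray_graph) : exists r, dist_le r (inl s : ray_graph) x.
  case: x => [v|n]; first by have [r /dist_le_inl] := Kcon s v; exists r.
  elim: n => [|n [r nr]].
    by exists 1%N; exact: dist_le_adj (dist_lexx _ _) adj_ray_start.
  by exists r.+1; apply: dist_le_adj nr _; apply/adj_inr; right.
move=> x y; have [r xr] := from_s x; have [r' yr] := from_s y.
by exists (r + r')%N; exact: dist_le_trans (dist_le_sym xr) yr.
Qed.

Lemma ray_graph_infinite : infinite_set [set: ray_graph].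
Proof.
rewrite -(setIT setT) => /(finite_preimage (f := inr)) fin.
by apply: infinite_nat; apply: sub_finite_set (fin _) => // x y _ _ [].
Qed.

Lemma max_degree_le_ray_graph D : (2 <= D)%N ->
  (forall v, ([set x | adj (inl v : ray_graph) x] #<= `I_D)%card) ->
  max_degree_le D ray_graph.
Proof.
move=> D2 Kdeg [v|n]; first exact: Kdeg.
pose g i : ray_graph := if i == 0%N then ray_pred n else inr n.+1.
apply: card_le_trans (_ : g @` `I_D #<= `I_D)%card; last exact: card_image_le.
apply: subset_card_le => x /adj_inr[->|->].
  by exists 0%N => //=; exact: ltnW.
by exists 1%N.
Qed.

(** The finite stages along which a map to another graph is built by induction. *)
Definition ray_initial (n : nat) : set ray_graph :=
  [set x | if x is inr m then (m <= n)%N else True].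

Lemma ray_initial_finite n : finite_set [set: K] -> finite_set (ray_initial n).
Proof.
move=> Kfin; apply: (@sub_finite_set _ _ (range inl `|` inr @` `I_n.+1)).
  by move=> [v _|m mn]; [left; exists v|right; exists m].
by rewrite finite_setU; split; apply: finite_image.
Qed.

Lemma ray_initial_pred n : ray_initial n (ray_pred n).
Proof. by case: n => //= n; exact: leqnSn. Qed.

Lemma ray_pred_neq n : ray_pred n <> inr n.
Proof. by case: n => // n [] /eqP; apply/negP; elim: n. Qed.

(** Only the end [inr n] of a stage has a neighbour outside it. *)
Lemma ray_initial_adj n x y :
  ray_initial n x -> x <> inr n -> adj x y -> ray_initial n y.
Proof.
case: x y => [u|m] [v|k] //=; first by move=> _ _ /andP[_ /eqP ->].
move=> mn mNn /orP[/eqP ->|/eqP mk].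
  by rewrite ltn_neqAle mn andbT; apply/eqP => mE; apply: mNn; rewrite mE.
by apply: leq_trans mn; rewrite mk.
Qed.

Lemma ray_initialS n x : ray_initial n.+1 x -> x = inr n.+1 \/ ray_initial n x.
Proof.
case: x => [v|m] /=; first by right.
by rewrite leq_eqVlt => /orP[/eqP ->|]; [left|right].
Qed.

(** From any vertex of [K], radius [r] covers [K], one more unit reaches the first ray vertex, and
    another one its neighbours. *)
Lemma isomorphic_ray_graph (H : sgraph) r :
  finite_set [set: K] -> connected_graph H -> infinite_set [set: H] ->
  (forall v : K, ~ degree2 (inl v : ray_graph)) ->
  (forall u v : K, dist_le r (inl u : ray_graph) (inl v)) ->
  gballs r.+2 ray_graph = gballs r.+2 H -> isomorphic ray_graph H.
Proof.
move=> Kfin Hcon Hinf Vdeg diam GH.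
have diam1 u v := dist_le_mono (leqnSn r) (diam u v).
have [y0 /gball_map[f0 [_ f0inj f0loc]]] :
    gballs r.+2 H (gball r.+2 (inl s : ray_graph)).
  by rewrite -GH; exists (inl s); exact: rooted_isomorphic_refl.
have d0 := dist_le_adj (diam s s) adj_ray_start.
have d0' x : ray_initial 0 x -> dist_le r.+1 (inl s : ray_graph) x.
  by case: x => [v _|m] /=; [exact: diam1|rewrite leqn0 => /eqP ->].
(* A pair holds the previous and the current vertex. If the current one is a dead end, nothing is
   asked of [next]. *)
have [|next nextP] := @choice (H * H)%type H
    (fun p w => (exists z, adj p.2 z /\ z <> p.1) -> adj p.2 w /\ w <> p.1).
  move=> p; have [[z zP]|no] := pselect (exists z, adj p.2 z /\ z <> p.1).
    by exists z.
  by exists p.1 => /no.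
(* The images of the vertices of the ray form a walk that never turns back. *)
pose step (p : H * H) := (p.2, next p).
pose walk n := iter n step (f0 (inl s), f0 (inr 0%N)).
pose f (x : ray_graph) :=
  match x with inl v => f0 (inl v) | inr n => (walk n).2 end.
have walk1 n : (walk n).1 = f (ray_pred n) by case: n.
have fS n : (exists z, adj (f (inr n)) z /\ z <> f (ray_pred n)) ->
    adj (f (inr n)) (f (inr n.+1)) /\ f (inr n.+1) <> f (ray_pred n).
  by rewrite -walk1; exact: (nextP (walk n)).
have f0E x : ray_initial 0 x -> f x = f0 x.
  by case: x => [//|m] /=; rewrite leqn0 => /eqP ->.
(* The end [inr n] is exempt because its next neighbour is not in the stage yet. *)
pose good n :=
  (forall x y, ray_initial n x -> ray_initial n y -> f x = f y -> x = y) /\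
  (forall x, ray_initial n x -> x <> inr n -> local_surj f x).
have good_pred n : good n -> adj (f (inr n)) (f (ray_pred n)).
  move=> [_ gl]; rewrite adj_sym.
  apply/(gl _ (ray_initial_pred n) (@ray_pred_neq n)).
  by exists (inr n) => //; rewrite adj_sym; apply/adj_inr; left.
(* A vertex of the image of the ray that looks like a vertex of K can only look
   like s, and then the walk has run into a second copy of K: together with the
   first copy and the walk it makes up all of H, which is then finite. *)
have good_degree2 n : good n -> degree2 (f (inr n)).
  case: n => [_|n gn].
    apply/(degree2_local (f := f0)); last exact: degree2_inr.
      move=> y z y0' z0'; apply: f0inj; first exact: dist_le_adj d0 y0'.
      exact: dist_le_adj d0 z0'.
    exact: f0loc.
  have [ginj gloc] := gn.
  have prev2 : degree2 (f (inr n)).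
    have nI : ray_initial n.+1 (inr n) by exact: leqnSn.
    have nN : inr n <> inr n.+1 :> ray_graph by exact: (@ray_pred_neq n.+1).
    apply/(degree2_local (f := f)); last exact: degree2_inr.
      move=> y z ny nz; apply: ginj; first exact: ray_initial_adj ny.
      exact: ray_initial_adj nz.
    exact: gloc.
  (* The newest vertex of the walk looks like some vertex of the ray graph; a ray vertex settles the
     claim, and [inl v] remains to be excluded. *)
  have [[v|m] [f1 [f1v f1inj f1loc]]] := 
    gballs_map GH (f (inr n.+1)); last first.
    rewrite -f1v; apply/(degree2_local (f := f1)); last exact: degree2_inr.
      move=> y z my mz; have d := dist_lexx r (inr m : ray_graph).
      apply: f1inj; first exact: dist_le_mono (dist_le_adj d my).
      exact: dist_le_mono (dist_le_adj d mz).
    by apply: f1loc; exact: dist_lexx.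
  have f1deg2 u : ~ degree2 (f1 (inl u)).
    move=> /(degree2_local (f := f1)) deg; apply: (Vdeg u); apply: deg.
      move=> y z uy uz; have d := diam1 v u.
      by apply: f1inj; [exact: dist_le_adj d uy|exact: dist_le_adj d uz].
    by apply: f1loc; exact: diam1.
  (* The previous vertex has degree two, so in the second copy it lies on the ray: this forces
     [v = s] and makes it the image of [inr 0]. *)
  have := good_pred _ gn; rewrite -f1v => /(f1loc _ (dist_lexx _ _))[t vt ft].
  case: t vt ft => [u _ ft|k /andP[/asboolP vs /eqP k0] ft].
    by move: prev2; rewrite -[f (inr n)]ft => /f1deg2.
  (* Each copy of [K] can be left only through its copy of [s], along the walk joining the two, so
     [C] is closed under adjacency. *)
  pose C := f @` ray_initial n.+1 `|` range (f1 \o inl).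
  exfalso; apply: Hinf; rewrite -(_ : C = setT).
    rewrite finite_setU; split; apply: finite_image => //.
    exact: ray_initial_finite.
  apply: (connected_closed (x := f (inr n))) => //.
    by left; exists (inr n) => //=; exact: leqnSn.
  have Cv z : adj (f1 (inl v)) z -> C z.
    move=> /(f1loc _ (dist_lexx _ _))[[u|k'] vk' <-]; first by right; exists u.
    move: vk' => /andP[_ /eqP ->]; left; exists (inr n); first exact: leqnSn.
    by rewrite -ft k0.
  move=> _ z [[x xI <-]|[u _ <-]] xz.
    have [xE|xN] := pselect (x = inr n.+1); first by apply: Cv; rewrite f1v -xE.
    have /(gloc _ xI xN)[y xy <-] := xz.
    by left; exists y => //; exact: ray_initial_adj xy.
  have [uv|uv] := pselect (u = v); first by apply: Cv; rewrite -uv.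
  have /(f1loc _ (diam1 v u))[[w _ <-|k' uk' _]] := xz.
    by right; exists w.
  by move: uk' => /andP[/asboolP us _]; case: uv; rewrite us.
have good_all n : good n.
  elim: n => [|n gn].
    split=> [x y xI yI|x xI xN z].
      rewrite !f0E // => /f0inj; apply; apply: dist_le_mono (leqnSn _) _;
        exact: d0'.
    rewrite f0E //; split=> [/(f0loc _ (d0' _ xI))[y xy <-]|[y xy <-]].
      by exists y => //; apply/f0E/ray_initial_adj/xy.
    apply/(f0loc _ (d0' _ xI)); exists y => //.
    by apply/esym/f0E/ray_initial_adj/xy.
  have [q [qN fnE]] := degree2_other (good_degree2 _ gn) (good_pred _ gn).
  have [ginj gloc] := gn.
  have {}fS : f (inr n.+1) = q.
    have [|/fnE[->//|//]] := fS n.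
    by exists q; split=> //; apply/fnE; right.
  (* If [q] were [f x], the edge from [f x] to [f (inr n)] would lift, so [x] would be [ray_pred n],
     excluded by [qN], or [inr n.+1], which is not in the stage. *)
  have fresh x : ray_initial n x -> f x <> q.
    move=> xI xq; have nI : ray_initial n (inr n) by exact: leqnn.
    have nq : adj (f (inr n)) q by apply/fnE; right.
    have [xE|xN] := pselect (x = inr n).
      by move: nq; rewrite -xq xE adj_irr.
    move: nq; rewrite -xq adj_sym => /(gloc _ xI xN)[y xy].
    move=> /(ginj _ _ (ray_initial_adj xI xN xy) nI) yE.
    move: xy; rewrite yE adj_sym => /adj_inr[xp|xn].
      by apply: qN; rewrite -xq xp.
    by move: xI; rewrite xn /= ltnn.
  split=> [x y /ray_initialS[->|xI] /ray_initialS[->|yI] //|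
           x /ray_initialS[->//|xI] _].
  - by rewrite fS => /esym /fresh.
  - by rewrite fS => /fresh.
  - exact: ginj.
  have [->|xN] := pselect (x = inr n); last exact: gloc.
  move=> z; rewrite fnE; split=> [[->|->]|[y /adj_inr[->|->] <-]].
  - by exists (ray_pred n) => //; apply/adj_inr; left.
  - by exists (inr n.+1) => //; apply/adj_inr; right.
  - by left.
  - by right.
pose rk (x : ray_graph) := if x is inr m then m else 0%N.
have rkI x n : (rk x <= n)%N -> ray_initial n x by case: x.
apply: (@isomorphic_local _ _ f (inl s)) => // [x y|x].
  apply: (good_all (maxn (rk x) (rk y))).1; apply: rkI.
    exact: leq_maxl.
  exact: leq_maxr.
(* One stage further, [x] is no longer the exempt end. *)
apply: (good_all (rk x).+1).2; first by apply: rkI; exact: leqnSn.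
by case: x => [//|m] [] /eqP; apply/negP; elim: m.
Qed.

End RayExtension.

(** * Isolated points of the space of graphs *)

Lemma finite_diameter (K : sgraph) (s : K) :
  finite_set [set: K] -> connected_graph K ->
  exists r, forall u v : K, dist_le r u v.
Proof.
move=> Kfin Kcon; have [g gP] := choice (Kcon s).
have /finite_seqP[X XE] := finite_image g Kfin.
have bound v : dist_le (\max_(i <- X) i) s v.
  apply: dist_le_mono (gP v); apply: leq_bigmax_seq => //.
  have : range g (g v) by exists v.
  by rewrite XE.
exists (\max_(i <- X) i + \max_(i <- X) i)%N => u v.
exact: dist_le_trans (dist_le_sym (bound u)) (bound v).
Qed.

(** The only non-empty open subset of [[set x]] is itself, so a nowhere dense set misses [x]. *)
Lemma isolated_not_meager (X : topologicalType) (S : set X) (x : X) :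
  open [set x] -> S x -> ~ meager S.
Proof.
move=> xo Sx [F [Fnd SE]]; move: Sx; rewrite SE => -[n _ Fx].
have [|U [_ [y Uy] Ux UF]] := Fnd n _ xo; first by exists x.
have yx : y = x := Ux _ Uy.
by have : (U `&` F n) x; [split=> //; rewrite -yx|rewrite UF].
Qed.

(** A distance below [2 ^- r] means agreement of balls at some radius above [r], hence at [r]. *)
Lemma open_class (R : realType) (D : nat) (G : cgraph D) (r : nat) :
  (forall H : cgraph D, gballs r G = gballs r H -> isomorphic G H) ->
  open [set \pi_(graph_space R D) G].
Proof.
move=> Giso; rewrite openE => _ ->; apply/nbhs_ballP.
exists (2 ^- r)%R => /=; first by rewrite invr_gt0 exprn_gt0.
move=> y; rewrite -[y]reprK; set H := repr y.
rewrite /ball /= /space_ball /= class_distE => /graph_dist_lt[r' GH rr'].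
apply/esym/pi_isomorphic/Giso/(gballs_le _ GH).
move: rr'; rewrite ltf_pV2 ?posrE ?exprn_gt0 // ltr_eXn2l ?ltr1n //.
exact: ltnW.
Qed.

Lemma colorable_classesP (R : realType) (D : nat) (G : cgraph D) :
  colorable_classes R D (\pi_(graph_space R D) G) <-> edge_colorable D G.
Proof.
split=> [[H Hcol]|Gcol]; last by exists G.
move=> /pi_isomorphic /isomorphic_sym[f [fb fadj]].
apply: edge_colorable_embed Hcol; first exact: (bij_inj fb).
by move=> x y; rewrite fadj.
Qed.

Lemma ray_graph_isolated (R : realType) (D : nat) (K : sgraph) (s : K) :
  (2 <= D)%N -> finite_set [set: K] -> connected_graph K ->
  (forall v : K, ([set x | adj (inl v : ray_graph s) x] #<= `I_D)%card) ->
  (forall v : K, ~ degree2 (inl v : ray_graph s)) ->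
  exists2 G : cgraph D, cg_graph G = ray_graph s &
    open [set \pi_(graph_space R D) G].
Proof.
move=> D2 Kfin Kcon Kdeg Kdeg2.
pose G := CGraph (ray_graph_connected (s := s) Kcon)
  (ray_graph_infinite (s := s)) (max_degree_le_ray_graph D2 Kdeg).
exists G => //; have [r diam] := finite_diameter s Kfin Kcon.
apply: (@open_class _ _ _ r.+2) => H.
apply: isomorphic_ray_graph => //; [exact: cg_connected|exact: cg_infinite|].
by move=> u v; apply: dist_le_inl.
Qed.

(** * The ray, a colorable isolated point *)

Definition point_graph : sgraph :=
  @SGraph unit (fun _ _ => false) (fun _ _ => erefl) (fun _ => erefl).

Lemma adj_point_ray (v : point_graph) (x : ray_graph (tt : point_graph)) :
  adj (inl v : ray_graph (tt : point_graph)) x -> x = inr 0%N.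
Proof. by case: x => [//|n] /andP[_ /eqP ->]. Qed.

(** Colors alternate along the ray: an edge gets the parity of its lower end in the numbering
    [rk]. *)
Lemma edge_colorable_ray (D : nat) :
  (2 <= D)%N -> edge_colorable D (ray_graph (tt : point_graph)).
Proof.
move=> D2; apply/edge_colorableP.
pose rk (x : ray_graph (tt : point_graph)) := if x is inr n then n.+1 else 0%N.
have rk_inj : injective rk by move=> [[]|m] [[]|n] //= [->].
have rk_adj x y : adj x y -> rk y = (rk x).+1 \/ rk x = (rk y).+1.
  case: x y => [[]|m] [[]|n] //=; do ?by move=> /andP[_ /eqP ->]; auto.
  by move=> /orP[/eqP ->|/eqP ->]; auto.
exists (fun x y => odd (minn (rk x) (rk y)) : nat); split=> [x y|x y _|x y z].
- by rewrite minnC.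
- by apply: leq_trans D2; case: odd.
move=> /rk_adj[|] yE /rk_adj[|] zE kE; apply: rk_inj; move: kE.
- by rewrite yE zE.
- by rewrite yE zE (minn_idPl (leqnSn _)) (minn_idPr (leqnSn _)) /=; case: odd.
- by rewrite zE yE (minn_idPl (leqnSn _)) (minn_idPr (leqnSn _)) /=; case: odd.
- by move=> _; apply: succn_inj; rewrite -yE -zE.
Qed.

(** * A finite obstruction to colorability *)

(* The graph K_(D,D) with one edge subdivided: the edge joining the vertices of
   index 0 on the two sides is replaced by a path through a new vertex, None. *)
Section Gadget.
Variable d : nat.
Local Notation D := d.+1.

(* The ordinal type 'I_D lives in a universe too large for the vertices of an
   sgraph. *)
Definition gadget_index : Type := {i : nat | (i < D)%N}.

Definition gadget_adj : rel (option (bool * gadget_index)) := fun x y =>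
  match x, y with
  | Some (b, i), Some (b', j) =>
      (b != b') && ~~ ((sval i == 0%N) && (sval j == 0%N))
  | Some (_, i), None | None, Some (_, i) => sval i == 0%N
  | None, None => false
  end.

Lemma gadget_adj_sym : symmetric gadget_adj.
Proof.
move=> [[b i]|] [[b' j]|] //=.
by rewrite eq_sym [(sval i == _) && _]andbC.
Qed.

Lemma gadget_adj_irr : irreflexive gadget_adj.
Proof. by move=> [[b i]|] //=; rewrite eqxx. Qed.

Definition gadget : sgraph := SGraph gadget_adj_sym gadget_adj_irr.
Definition hub : gadget := None.
Definition gvertex (b : bool) (i : 'I_D) : gadget :=
  Some (b, exist _ (val i) (ltn_ord i)).

Variant gadget_spec : gadget -> Prop :=
  | GadgetHub : gadget_spec hub
  | GadgetVertex b i : gadget_spec (gvertex b i).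

Lemma gadgetP x : gadget_spec x.
Proof.
case: x => [[b [i iD]]|]; last exact: GadgetHub.
rewrite (_ : Some _ = gvertex b (Ordinal iD)); first exact: GadgetVertex.
by congr (Some (_, exist _ _ _)); exact: bool_irrelevance.
Qed.

Lemma gvertex_inj b b' i j : gvertex b i = gvertex b' j -> b = b' /\ i = j.
Proof. by move=> [-> /val_inj]. Qed.

(** Numbers the [D] neighbours of a side vertex; between the two vertices of index 0, the hub stands
    in for the missing partner. *)
Definition gadget_nbr (b : bool) (i j : 'I_D) : gadget :=
  if (i == ord0) && (j == ord0) then hub else gvertex (~~ b) j.

Lemma adj_gvertex b i b' j : adj (gvertex b i) (gvertex b' j) =
  (b != b') && ~~ ((i == ord0) && (j == ord0)).
Proof. by []. Qed.

Lemma adj_hub b i : adj hub (gvertex b i) = (i == ord0).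
Proof. by []. Qed.

Lemma adj_gadget_nbr b i j : adj (gvertex b i) (gadget_nbr b i j).
Proof.
rewrite /gadget_nbr; case: ifPn => [/andP[/eqP -> _] //|ij].
by rewrite adj_gvertex ij andbT; case: b.
Qed.

Lemma gadget_nbrP b i x : adj (gvertex b i) x -> exists j, x = gadget_nbr b i j.
Proof.
case: (gadgetP x) => [|b' j].
  by rewrite adj_sym adj_hub => i0; exists ord0; rewrite /gadget_nbr i0 eqxx.
rewrite adj_gvertex => /andP[bb' ij]; exists j.
by rewrite /gadget_nbr (negbTE ij); case: b b' bb' => -[].
Qed.

Lemma gadget_nbr_inj b i : injective (gadget_nbr b i).
Proof.
move=> j k; rewrite /gadget_nbr; case: ifPn => [/andP[-> /eqP ->]|_].
  by case: ifPn => // /andP[_ /eqP ->].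
by case: ifPn => // _ /gvertex_inj[].
Qed.

(* The color of the edge from the hub to a0 occurs at every vertex on the other
   side, and the edge bearing it goes neither to the hub nor to a0: this injects
   one side into the other side minus a0. *)
Lemma gadget_not_edge_colorable : ~ edge_colorable D gadget.
Proof.
move=> /edge_colorableP[k [ksym kD kinj]].
pose a0 := gvertex false ord0; pose b0 := gvertex true ord0.
have hub_a0 : adj hub a0 by rewrite adj_hub.
have hub_b0 : adj hub b0 by rewrite adj_hub.
have kb0 : k hub b0 <> k hub a0.
  by move=> /(kinj _ _ _ hub_b0 hub_a0) /gvertex_inj[].
(* The [D] edges at a side vertex have distinct colors among [D], so every color occurs there. *)
pose col (j i : 'I_D) : 'I_D :=
  inord (k (gvertex true j) (gadget_nbr true j i)).
have colE j i : val (col j i) = k (gvertex true j) (gadget_nbr true j i).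
  by rewrite /= inordK //; apply: kD; exact: adj_gadget_nbr.
have col_inj j : injective (col j).
  move=> i i' /(congr1 val); rewrite !colE => kE.
  apply: (@gadget_nbr_inj true j); by apply: kinj kE; exact: adj_gadget_nbr.
have [|p pP] := @choice 'I_D 'I_D
    (fun j i => k (gvertex true j) (gadget_nbr true j i) = k hub a0).
  move=> j; have [g _ gK] := injF_bij (@col_inj j).
  exists (g (inord (k hub a0))).
  by rewrite -colE gK /= inordK //; exact: kD.
have pE j : gadget_nbr true j (p j) = gvertex false (p j).
  rewrite /gadget_nbr; case: ifPn => // /andP[/eqP j0 p0]; case: kb0.
  by rewrite -(pP j) /gadget_nbr p0 j0 eqxx /= ksym.
have pA j : adj (gvertex false (p j)) (gvertex true j).
  by rewrite adj_sym -pE; exact: adj_gadget_nbr.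
have pk j : k (gvertex false (p j)) (gvertex true j) = k hub a0.
  by rewrite -(pP j) pE ksym.
have p_inj : injective p.
  move=> j j' pp; suff /gvertex_inj[] : gvertex true j = gvertex true j' by [].
  by apply: (kinj (gvertex false (p j))); rewrite ?pk // pp // pk.
(* Being injective, [p] also hits index 0, so [a0] has a second edge of the color of its edge to the
   hub. *)
have [g _ gK] := injF_bij p_inj.
have := pA (g ord0); have := pk (g ord0).
rewrite gK -/a0 [k hub _]ksym => kE aE.
by have := kinj _ _ hub aE _ kE; rewrite adj_sym => /(_ hub_a0).
Qed.

Lemma gadget_finite : finite_set [set: gadget].
Proof.
pose g (x : option (bool * 'I_D)) :=
  if x is Some (b, i) then gvertex b i else hub.
apply: (@sub_finite_set _ _ (range g)); last exact/finite_image/finite_finset.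
by move=> x _; case: (gadgetP x) => [|b i]; [exists None|exists (Some (b, i))].
Qed.

Lemma gadget_connected : (1 <= d)%N -> connected_graph gadget.
Proof.
move=> d1; pose i1 : 'I_D := inord 1.
have i1N : (i1 == ord0) = false by rewrite -val_eqE /= inordK.
suff from_hub x : exists r, dist_le r hub x.
  move=> x y; have [r xr] := from_hub x; have [r' yr] := from_hub y.
  by exists (r + r')%N; exact: dist_le_trans (dist_le_sym xr) yr.
case: (gadgetP x) => [|b i]; first by exists 0%N; exact: dist_lexx.
have [->|i0] := eqVneq i ord0.
  by exists 1%N; apply: dist_le_adj (dist_lexx _ _) _; rewrite adj_hub.
(* The path passes through the vertex of index 0 on the opposite side. *)
exists 2%N; apply: (@dist_le_adj _ _ _ (gvertex (~~ b) ord0)).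
  by apply: dist_le_adj (dist_lexx _ _) _; rewrite adj_hub.
by rewrite adj_gvertex (negbTE i0) andbF andbT; case: b.
Qed.

Lemma three_neighbours_not_degree2 (G : sgraph) (x : G) (g : 'I_3 -> G) :
  injective g -> (forall i, adj x (g i)) -> ~ degree2 x.
Proof.
move=> ginj xg [y [z [yz xE]]].
(* With only two neighbours available, [h] would inject three indices into [bool]. *)
pose h i := `[< g i = y >].
have h_inj : injective h.
  move=> i j hij; apply: ginj; move: hij; rewrite /h.
  have /xE[iE|iE] := xg i; have /xE[jE|jE] := xg j; rewrite iE jE //.
    by rewrite (asboolT (erefl y)) => /esym/asboolP.
  by rewrite (asboolT (erefl y)) => /asboolP.
by have := leq_card h h_inj; rewrite card_ord card_bool.
Qed.

(** Index 2 runs past the list and yields the default value, the first ray vertex. *)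
Definition hub_nbr (i : 'I_3) : ray_graph hub :=
  nth (inr 0%N) [:: inl (gvertex false ord0); inl (gvertex true ord0)] i.

Lemma hub_nbr_inj : injective hub_nbr.
Proof.
by move=> [[|[|[|//]]] i3] [[|[|[|//]]] j3] // _; exact: val_inj.
Qed.

Lemma hub_nbrP x : adj (inl hub : ray_graph hub) x <-> exists i, x = hub_nbr i.
Proof.
split=> [|[i ->]]; last first.
  by case: i => [[|[|[|//]]] i3]; rewrite /hub_nbr /= ?eqxx ?asboolT.
case: x => [v|n]; last first.
  by move=> /andP[_ /eqP ->]; exists (inord 2); rewrite /hub_nbr inordK.
case: (gadgetP v) => // b i /eqP i0; have {i0} -> : i = ord0 by exact: val_inj.
by case: b; [exists (inord 1)|exists ord0]; rewrite /hub_nbr ?inordK.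
Qed.

Lemma adj_inl_gvertex b i (x : ray_graph hub) :
  adj (inl (gvertex b i) : ray_graph hub) x <->
  exists j, x = inl (gadget_nbr b i j).
Proof.
split=> [|[j ->]]; last exact: adj_gadget_nbr.
by case: x => [v /gadget_nbrP[j ->]|n /andP[/asboolP]//]; exists j.
Qed.

(** The ray gives the hub its third neighbour, and side vertices have [d.+1], at least three. *)
Lemma gadget_ray_degree2 : (2 <= d)%N ->
  forall v : gadget, ~ degree2 (inl v : ray_graph hub).
Proof.
move=> d2 v; case: (gadgetP v) => [|b i].
  apply: (three_neighbours_not_degree2 hub_nbr_inj) => i.
  by apply/hub_nbrP; exists i.
pose w (j : 'I_3) : 'I_D := widen_ord (d2 : (2 < D)%N) j.
apply: (@three_neighbours_not_degree2 _ _
  (fun j => inl (gadget_nbr b i (w j)) : ray_graph hub)).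
  by move=> j k [] /gadget_nbr_inj /(congr1 val) jk; exact: val_inj.
by move=> j; apply/adj_inl_gvertex; exists (w j).
Qed.

Lemma card_le_range_ord (T : Type) (n : nat) (A : set T) (g : 'I_n -> T) :
  A `<=` range g -> (A #<= `I_n)%card.
Proof.
move=> Ag; apply: card_le_trans (subset_card_le Ag) _.
apply: card_le_trans (card_image_le _ _) _.
by rewrite -(card_le_eql card_II) card_lexx.
Qed.

Lemma gadget_ray_max_degree : (2 <= d)%N -> forall v : gadget,
  ([set x | adj (inl v : ray_graph hub) x] #<= `I_D)%card.
Proof.
move=> d2 v; case: (gadgetP v) => [|b i].
  apply: (@card_le_trans _ _ _ `I_3); last by rewrite card_le_II.
  apply: (card_le_range_ord (g := hub_nbr)) => x /hub_nbrP[i ->].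
  by exists i.
apply: (card_le_range_ord (g := fun j => inl (gadget_nbr b i j))).
by move=> x /adj_inl_gvertex[j ->]; exists j.
Qed.

End Gadget.

(** * The two isolated points combined *)

Theorem theorem4p18 (R : realType) (D : nat) (hD : (3 <= D)%N) :
  ~ meager (colorable_classes R D) /\ ~ comeager (colorable_classes R D).
Proof.
have D2 : (2 <= D)%N by exact: ltnW.
split.
- have [||v|v|G GE Gopen] := @ray_graph_isolated R D point_graph tt D2.
  + exact: finite_finset.
  + by move=> [] []; exists 0%N; exact: dist_lexx.
  + apply: card_le_trans (_ : [set inr 0%N] #<= `I_D)%card.
      by apply: subset_card_le => x /adj_point_ray.
    by rewrite (card_le_eql card_set1) card_le_II; exact: ltnW.
  + move=> [y [z [yz vE]]]; apply: yz.
    rewrite (adj_point_ray ((vE y).2 (or_introl erefl))).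
    by rewrite (adj_point_ray ((vE z).2 (or_intror erefl))).
  apply: (isolated_not_meager Gopen); apply/colorable_classesP.
  by rewrite GE; exact: edge_colorable_ray.
case: D hD D2 => [//|d] d2 D2.
have [||||G GE Gopen] := @ray_graph_isolated R d.+1 (gadget d) (hub d) D2.
- exact: gadget_finite.
- exact/gadget_connected/ltnW.
- exact: gadget_ray_max_degree.
- exact: gadget_ray_degree2.
apply: (isolated_not_meager Gopen) => /colorable_classesP.
(* A coloring of the whole graph would restrict to the gadget. *)
rewrite GE => Gcol; apply: (@gadget_not_edge_colorable d).
by apply: (@edge_colorable_embed _ _ (ray_graph (hub d)) inl) => // x y [].
Qed.
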